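(* Let $\mathbf{F}=\bigoplus_{k=0}^rF^k$ be a symbol system of rank $r\ge2$ on a complex vector space $W$ of dimension $n$, and let $Q^{(k)}_1,\dots,Q^{(k)}_{s_k}$ be a basis of $F^k$ for $2\le k\le r$. If $M(\mathbf{F})\subset\mathbb{P}V_{\mathbf{F}}$ is a complete intersection, then it is the complete intersection of the $m=\sum_{k=2}^rs_k=\operatorname{codim}_{\mathbb{P}V_{\mathbf F}}M(\mathbf F)$ hyperquadrics $\{f_i^{(j)}=0\}$, $2\le j\le r$, $1\le i\le s_j$, defined in the context; that is, its homogeneous vanishing ideal is $$I(M(\mathbf{F}))=\bigl(f_i^{(j)}\mid 2\le j\le r,\ 1\le i\le s_j\bigr).$$
   Context: Everything is over $\mathbb{C}$. Elements of $\operatorname{Sym}^kW^*$ are viewed as symmetric $k$-linear forms on $W$, equivalently homogeneous polynomials of degree $k$ in coordinates $x_1,\dots,x_n$. For $w\in W$ let $\iota_w:\operatorname{Sym}^{k+1}W^*\to\operatorname{Sym}^kW^*$, $\iota_w\varphi(w_1,\dots,w_k)=\varphi(w,w_1,\dots,w_k)$, and for $F^k\subset\operatorname{Sym}^kW^*$ put $\mathbf{prolong}(F^k)=\bigcap_{w\in W}\iota_w^{-1}(F^k)$. A graded subspace $\mathbf F=\bigoplus_{k\ge0}F^k\subset\operatorname{Sym}(W^* )$ with $F^0=\mathbb{C}$, $F^1=W^*$, $F^r\ne0$, $F^{r+i}=0$ for $i\ge1$ is a symbol system of rank $r$ if $F^{k+1}\subset\mathbf{prolong}(F^k)$ for $1\le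 k\le r$. Put $V_{\mathbf F}=\mathbb{C}\oplus W\oplus(F^2)^*\oplus\cdots\oplus(F^r)^*$. $M(\mathbf F)\subset\mathbb{P}V_{\mathbf F}$ is the Zariski closure of the image of the rational map $\mathbb{P}(\mathbb{C}\oplus W)\dashrightarrow\mathbb{P}V_{\mathbf F}$, $[t:w]\mapsto[t^r:t^{r-1}w:t^{r-2}\iota_w^2:\cdots:t\,\iota_w^{r-1}:\iota_w^r]$, where $\iota_w^k\in(F^k)^*$ is $\phi\mapsto\phi(w,\dots,w)$. It has dimension $n$. Euler-symmetric projective varieties are, up to projective equivalence, exactly the varieties $M(\mathbf F)$ (a known result). Coordinates on $\mathbb{P}V_{\mathbf F}$ are $[z_0:z_1:\cdots:z_n:w^{(2)}_1:\cdots:w^{(2)}_{s_2}:\cdots:w^{(r)}_1:\cdots:w^{(r)}_{s_r}]$, where $z_0$ is the coordinate on $\mathbb{C}$, $z_1,\dots,z_n$ are the coordinates on $W$ and $w^{(k)}_i$ is the coordinate on $(F^k)^*$ given by $Q^{(k)}_i$. The quadratic polynomials are $$f_i^{(2)}=z_0w_i^{(2)}-Q_i^{(2)}(z_1,\dots,z_n)\quad(1\le i\le s_2),$$ $$f_i^{(j)}=z_0w_i^{(j)}-\sum_{l=1}^{s_{j-1}}g_l^{(j-1)}(z_1,\dots,z_n)\,w_l^{(j-1)}\quad(2<j\le r,\ 1\le i\le s_j),$$ where the $g_l^{(j-1)}$ (depending also on $i$) are linear forms in $n$ variables satisfying $Q_i^{(j)}=\sum_{l=1}^{s_{j-1}}g_l^{(j-1)}Q_l^{(j-1)}$;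 such linear forms exist by the prolongation property and Euler's identity, and one choice is fixed. All $f_i^{(j)}$ vanish on $M(\mathbf F)$. A subvariety $Z$ of dimension $n$ in $\mathbb{P}^{n+c}$ is a complete intersection if its homogeneous vanishing ideal $I(Z)$ can be generated by $c$ elements. *)

(* Defs.v *)
From HB Require Import structures.
From mathcomp Require Import all_boot all_order all_algebra perm.
From mathcomp Require Import classical_sets reals.
From mathcomp Require Import complex.
From mathcomp Require Import mpoly.

Set Implicit Arguments.
Unset Strict Implicit.
Unset Printing Implicit Defensive.

Import GRing.Theory.

Local Open Scope ring_scope.
Local Open Scope classical_set_scope.

(** * Projective geometry in P^(q-1), with q homogeneous coordinates *)

Section ProjectiveGeometry.
Variables (K : fieldType) (q : nat).

Implicit Types (A S : set {mpoly K[q]}) (Z Y : set ('I_q -> K)).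

(* A subset of P^(q-1) is handled through the set of all the nonzero vectors
   that represent its points. *)
Definition proj_vector : set ('I_q -> K) := [set v | exists i, v i != 0].

Definition homogeneous (p : {mpoly K[q]}) : Prop := exists d, p \is d.-homog.

Definition zero_locus S : set ('I_q -> K) :=
  [set v | proj_vector v /\ forall p, S p -> p.@[v] = 0].

Definition zariski_closed Z : Prop :=
  exists S, (forall p, S p -> homogeneous p) /\ Z = zero_locus S.

Definition zariski_closure Z : set ('I_q -> K) :=
  [set v | forall Y, zariski_closed Y -> Z `<=` Y -> Y v].

Definition irreducible_set Z : Prop :=
  Z !=set0 /\
  forall Y1 Y2, zariski_closed Y1 -> zariski_closed Y2 ->
    Z `<=` Y1 `|` Y2 -> Z `<=` Y1 \/ Z `<=` Y2.

Definition irreducible_chain Z (d : nat) : Prop :=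
  exists Y : nat -> set ('I_q -> K),
    (forall i, (i <= d)%N ->
       [/\ zariski_closed (Y i), irreducible_set (Y i) & Y i `<=` Z]) /\
    (forall i, (i < d)%N -> Y i `<` Y i.+1).

(* Krull dimension of the closed set Z. *)
Definition proj_dim Z (d : nat) : Prop :=
  irreducible_chain Z d /\
  forall d', irreducible_chain Z d' -> (d' <= d)%N.

(* The successor is there because the ambient space has dimension q - 1. *)
Definition proj_codim Z (c : nat) : Prop :=
  exists2 d, proj_dim Z d & (d + c).+1 = q.

Definition ideal_generated A : set {mpoly K[q]} :=
  [set p | exists (k : nat) (a b : 'I_k -> {mpoly K[q]}),
     (forall i, A (b i)) /\ p = \sum_(i < k) a i * b i].

Definition vanishing_ideal Z : set {mpoly K[q]} :=
  ideal_generated [set p | homogeneous p /\ forall v, Z v -> p.@[v] = 0].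

Definition complete_intersection Z : Prop :=
  exists2 c, proj_codim Z c &
  exists h : 'I_c -> {mpoly K[q]},
    vanishing_ideal Z = ideal_generated (range h).

End ProjectiveGeometry.

(** * Symmetric multilinear forms and symbol systems *)

Section SymbolSystems.
Variables (K : fieldType) (W : vectType K).

Definition kform (k : nat) := k.-tuple W -> K.

Definition tuple_set k (v : k.-tuple W) (i : 'I_k) (x : W) : k.-tuple W :=
  [tuple if j == i then x else tnth v j | j < k].

Definition is_symform k (phi : kform k) : Prop :=
  (forall (v : k.-tuple W) (i : 'I_k) (a : K) (x y : W),
     phi (tuple_set v i (a *: x + y)) =
     a * phi (tuple_set v i x) + phi (tuple_set v i y)) /\
  (forall (v : k.-tuple W) (sigma : 'S_k),
     phi [tuple tnth v (sigma j) | j < k] = phi v).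

Definition iota k (w : W) (phi : kform k.+1) : kform k :=
  fun v => phi [tuple of w :: v].

Definition prolong k (Fk : set (kform k)) : set (kform k.+1) :=
  [set phi | is_symform phi /\ forall w, Fk (iota w phi)].

Definition sym_subspace k (Fk : set (kform k)) : Prop :=
  [/\ forall phi, Fk phi -> is_symform phi,
      Fk (fun=> 0) &
      forall (a : K) phi psi, Fk phi -> Fk psi ->
        Fk (fun v => a * phi v + psi v)].

Record symbol_system (r : nat) (F : forall k, set (kform k)) : Prop :=
  SymbolSystem {
    symbol_subspace : forall k, sym_subspace (F k);
    symbol_deg0 : F 0%N = [set phi | is_symform phi];
    symbol_deg1 : F 1%N = [set phi | is_symform phi];
    symbol_top_neq0 : exists2 phi, F r phi & exists v, phi v != 0;
    symbol_above_top :
      forall i, (1 <= i)%N -> forall phi, F (r + i)%N phi -> phi =1 (fun=> 0);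
    symbol_prolong :
      forall k, (1 <= k <= r)%N -> F k.+1 `<=` prolong (F k)
  }.

Definition form_basis k (Fk : set (kform k)) (s : nat)
    (Q : 'I_s -> kform k) : Prop :=
  [/\ forall i, Fk (Q i),
      forall phi, Fk phi ->
        exists c : 'I_s -> K, forall v, phi v = \sum_(i < s) c i * Q i v &
      forall c : 'I_s -> K,
        (forall v, \sum_(i < s) c i * Q i v = 0) -> forall i, c i = 0].

(* The polynomial phi(x, ..., x), where x = \sum_i x_i e_i. *)
Definition form_poly n (e : n.-tuple W) k (phi : kform k) : {mpoly K[n]} :=
  \sum_(t : k.-tuple 'I_n)
    phi (map_tuple (tnth e) t) *: \prod_(i <- t) 'X_i.

End SymbolSystems.

(** * The variety M(F) and its quadrics *)

Section EulerSymmetric.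
Variables (K : fieldType) (W : vectType K) (n r : nat) (e : n.-tuple W).
Variables (s : nat -> nat) (Q : forall k, 'I_(s k) -> kform W k).

(* Indices of the coordinates on V_F = C + W + (F^2)^* + ... + (F^r)^*: None is
   z_0, Some (inl i) is z_i, and Some (inr (existT j i)) is w^(j+2)_i, so that
   j < r - 1 stands for the degree j + 2 ranging from 2 to r. *)
Definition vindex : finType :=
  option ('I_n + {j : 'I_r.-1 & 'I_(s j.+2)}).

Definition euler_map (t : K) (w : W) (x : vindex) : K :=
  match x with
  | None => t ^+ r
  | Some (inl i) => t ^+ r.-1 * coord e i w
  | Some (inr y) =>
      t ^+ (r - (tag y).+2) * Q (tagged y) (nseq_tuple (tag y).+2 w)
  end.

(* No saturation under scaling is needed over an algebraically closed field
   when r > 0: euler_map (a * t) (a *: w) = a ^+ r * euler_map t w. *)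
Definition euler_image : set ('I_#|vindex| -> K) :=
  [set v | proj_vector v /\
     exists t w, v = fun i => euler_map t w (enum_val i)].

Definition euler_variety : set ('I_#|vindex| -> K) :=
  zariski_closure euler_image.

Definition zvar0 : {mpoly K[#|vindex|]} := 'X_(enum_rank (None : vindex)).

Definition zvar (i : 'I_n) : {mpoly K[#|vindex|]} :=
  'X_(enum_rank (Some (inl i) : vindex)).

Definition wvar (j : nat) (hj : (j < r.-1)%N) (i : 'I_(s j.+2)) :
    {mpoly K[#|vindex|]} :=
  'X_(enum_rank (Some (inr
        (existT (fun j : 'I_r.-1 => 'I_(s j.+2)) (Ordinal hj) i)) : vindex)).

Definition in_z (p : {mpoly K[n]}) : {mpoly K[#|vindex|]} :=
  p \mPo [tuple zvar i | i < n].

Variable g : forall k, 'I_(s k.+1) -> 'I_(s k) -> {mpoly K[n]}.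

(* g k i l is the linear form g_l^(k) used to write Q_i^(k+1). *)
Definition linear_relations : Prop :=
  forall k, (2 <= k < r)%N -> forall i : 'I_(s k.+1),
    (forall l : 'I_(s k), g i l \is 1.-homog) /\
    form_poly e (Q i) = \sum_(l < s k) g i l * form_poly e (Q l).

(* quadric hj i is f_i^(j+2). *)
Definition quadric (j : nat) :
    (j < r.-1)%N -> 'I_(s j.+2) -> {mpoly K[#|vindex|]} :=
  match j with
  | 0%N => fun hj i =>
      zvar0 * wvar hj i - in_z (form_poly e (Q i))
  | j'.+1 => fun hj i =>
      zvar0 * wvar hj i
      - \sum_(l < s j'.+2) in_z (g i l) * wvar (ltnW hj) l
  end.

Definition quadrics : set {mpoly K[#|vindex|]} :=
  [set f | exists (j : nat) (hj : (j < r.-1)%N) (i : 'I_(s j.+2)),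
     f = quadric hj i].

End EulerSymmetric.

Arguments euler_variety {K W n} r e {s} Q.
Arguments quadrics {K W n} r e {s} Q g.

(* Main.v *)
Require Import Defs.
From HB Require Import structures.
From mathcomp Require Import all_boot all_order all_algebra perm.
From mathcomp Require Import classical_sets reals.
From mathcomp Require Import complex.
From mathcomp Require Import mpoly.
From mathcomp Require Import zify.

Set Implicit Arguments.
Unset Strict Implicit.
Unset Printing Implicit Defensive.

Import Order.TTheory GRing.Theory Num.Theory.

Local Open Scope ring_scope.
Local Open Scope classical_set_scope.

(** The variety M(F) is the closure of the image of (t, w) |-> euler_map t w,
    and its ideal I is homogeneous.  Three facts about I decide the matter.

    - I contains no nonzero form of degree 0 or 1
      ([euler_variety_low_degree]): the coordinates of the map are linearly
      independent functions of (t, w), because the Q_i^(k) are linearly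
      independent as symmetric forms, hence by polarization as polynomials.
    - The m quadrics f_i^(j) lie in I ([quadric_in_ideal]).  They are linearly
      independent, as seen by evaluating them at the m points [wpoint y] where
      z_0 = 1, one coordinate w^(k)_l is 1 and everything else vanishes:
      f_x takes the value 1 at the point y if x = y, and 0 otherwise
      ([quadric_of_wpoint]).
    - The dimension of M(F) is at least n, because the closures of the images
      of the spans of e_1, ..., e_d, in the chart t = 1 and for 0 <= d <= n,
      form a strictly increasing chain of irreducible closed sets ([euler_variety_chain]).

    Suppose now that I = (h_1, ..., h_c) where c is the codimension.  The last
    fact gives c <= m.  Write f_y = sum_k a_yk h_k and let A be the m x c matrix
    of the constant terms of the a_yk.  As the h_k have no terms of degree 0 or
    1, the degree 2 part of that equation is f_y = sum_k A_yk (h_k)_2, and its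
    values at the points wpoint x show that A times the matrix of the values of
    the (h_k)_2 is the identity.  So m <= c ([quadrics_vs_generators]); hence
    c = m and A is invertible.  In other words the quadrics and the h_k have
    the same span in the quotient of I by its product with the irrelevant ideal,
    and Nakayama's lemma in its graded form ([graded_nakayama]) says that the
    quadrics generate I.  Only the inequality dim >= n is proved directly; the
    opposite one comes out of m <= c. *)

(** * Ideals of polynomials *)

Section Ideals.
Variables (K : fieldType) (q : nat).
Implicit Types (A B : set {mpoly K[q]}) (p : {mpoly K[q]}).

Lemma ideal_gen A p : A p -> ideal_generated A p.
Proof.
move=> Ap; exists 1%N, (fun=> 1), (fun=> p); split=> //.
by rewrite big_ord1 mul1r.
Qed.

Lemma ideal0 A : ideal_generated A 0.
Proof.
by exists 0%N, (fun=> 0), (fun=> 0); split=> [[]//|]; rewrite big_ord0.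
Qed.

Lemma idealD A p1 p2 :
  ideal_generated A p1 -> ideal_generated A p2 -> ideal_generated A (p1 + p2).
Proof.
move=> [k1 [a1 [b1 [Ab1 ->]]]] [k2 [a2 [b2 [Ab2 ->]]]].
exists (k1 + k2)%N.
exists (fun i => match split i with inl j => a1 j | inr j => a2 j end).
exists (fun i => match split i with inl j => b1 j | inr j => b2 j end).
split=> [i|]; first by case: (split i).
rewrite big_split_ord /=; congr (_ + _); apply: eq_bigr => i _.
  by rewrite (unsplitK (inl i : 'I_k1 + 'I_k2)).
by rewrite (unsplitK (inr i : 'I_k1 + 'I_k2)).
Qed.

Lemma idealMl A a p : ideal_generated A p -> ideal_generated A (a * p).
Proof.
move=> [k [c [b [Ab ->]]]]; exists k, (fun i => a * c i), b; split=> //.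
by rewrite mulr_sumr; apply: eq_bigr => i _; rewrite mulrA.
Qed.

Lemma idealZ A c p : ideal_generated A p -> ideal_generated A (c *: p).
Proof. by rewrite -mul_mpolyC; apply: idealMl. Qed.

Lemma idealB A p1 p2 :
  ideal_generated A p1 -> ideal_generated A p2 -> ideal_generated A (p1 - p2).
Proof.
by move=> h1 h2; apply: idealD => //; rewrite -mulN1r; apply: idealMl.
Qed.

Lemma ideal_sum A (I : Type) (r : seq I) (P : pred I) (G : I -> {mpoly K[q]}) :
  (forall i, P i -> ideal_generated A (G i)) ->
  ideal_generated A (\sum_(i <- r | P i) G i).
Proof. by move=> AG; apply: big_ind => //; [apply: ideal0 | apply: idealD]. Qed.

Lemma ideal_generated_sub A B :
  A `<=` ideal_generated B -> ideal_generated A `<=` ideal_generated B.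
Proof.
move=> AB p [k [a [b [Ab ->]]]]; apply: ideal_sum => i _.
by apply/idealMl/AB/Ab.
Qed.

(** Grouping the terms of a combination by generator turns the unspecified
    number of terms into one coefficient for each of the [h i]. *)
Lemma ideal_range k (h : 'I_k -> {mpoly K[q]}) p :
  ideal_generated (range h) p -> exists a, p = \sum_(i < k) a i * h i.
Proof.
move=> [l [a [b [hb ->]]]].
have /fin_all_exists[f bE] : forall i, exists j, b i = h j.
  by move=> i; have [j _ <-] := hb i; exists j.
exists (fun j => \sum_(i < l | f i == j) a i).
under [RHS]eq_bigr do rewrite mulr_suml.
rewrite (exchange_big_dep xpredT) //=; apply: eq_bigr => i _.
by rewrite (big_pred1 (f i)) ?bE // => j; rewrite eq_sym.
Qed.

End Ideals.

(** * Homogeneous components and graded ideals *)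

Section Homogeneous.
Variables (K : fieldType) (q : nat).
Implicit Types (a b p : {mpoly K[q]}) (d i : nat).

Local Notation component := (pihomog mdeg).

Lemma pihomog_dhomogE d i p :
  p \is i.-homog -> component d p = if i == d then p else 0.
Proof.
move=> p_hom; case: eqP => [<-|/eqP ne]; first by rewrite pihomog_dE.
by rewrite (pihomog_ne0 ne).
Qed.

Lemma pihomogM_dhomog d i a b : b \is i.-homog ->
  component d (a * b) = if (i <= d)%N then component (d - i) a * b else 0.
Proof.
move=> bh.
rewrite {1}(@pihomog_partitionE _ _ mdeg (maxn (mmeasure mdeg a) d.+1) a);
  last exact: leq_maxl.
rewrite mulr_suml raddf_sum /=.
under eq_bigr => j _ do
  rewrite (pihomog_dhomogE d (dhomogM (pihomogP mdeg j a) bh)).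
case: leqP => [le_id|lt_di]; last first.
  by rewrite big1 // => j _; case: eqP => // E; rewrite -E ltnNge leq_addl in lt_di.
have lt_k : (d - i < maxn (mmeasure mdeg a) d.+1)%N.
  by rewrite leq_max; apply/orP; right; rewrite ltnS leq_subr.
rewrite (bigD1 (Ordinal lt_k)) //= subnK // eqxx big1 ?addr0 // => j ne.
case: eqP => // E; case/eqP: ne; apply: val_inj => /=.
by have := addnK i (val j); rewrite [(_ + i)%N]E => <-.
Qed.

Lemma pihomogM d a b : component d (a * b) =
  \sum_(i < d.+1) component (d - i) a * component i b.
Proof.
rewrite {1}(@pihomog_partitionE _ _ mdeg (maxn (mmeasure mdeg b) d.+1) b);
  last exact: leq_maxl.
rewrite mulr_sumr raddf_sum /=.
under eq_bigr => j _ do rewrite (pihomogM_dhomog d a (pihomogP mdeg j b)).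
rewrite -big_mkcond /=.
by rewrite (big_ord_widen _ (fun i => component (d - i) a * component i b)
  (leq_maxr (mmeasure mdeg b) d.+1)).
Qed.

Lemma pihomog0E p : component 0 p = (p@_0)%:MP.
Proof.
apply/mpolyP=> m; rewrite mcoeffC pihomogE raddf_sum /=.
under eq_bigr do rewrite mcoeffZ mcoeffX.
rewrite -big_filter.
case: eqP => [->|/eqP m0]; last first.
  rewrite mulr0 big1_seq // => m' /andP[_].
  rewrite mem_filter /= mdeg_eq0 => /andP[/eqP-> _].
  by rewrite eq_sym (negPf m0) mulr0.
rewrite mulr1; have [m0|m0] := boolP (0%MM \in msupp p); last first.
  rewrite (memN_msupp_eq0 m0) big1_seq // => m' /andP[_]; rewrite mem_filter /=.
  by rewrite mdeg_eq0 => /andP[/eqP-> h]; rewrite h in m0.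
rewrite (bigD1_seq 0%MM) ?filter_uniq ?msupp_uniq ?mem_filter ?mdeg0 //=.
rewrite eqxx mulr1 big1_seq ?addr0 // => m' /andP[ne].
by rewrite mem_filter /= mdeg_eq0 (negPf ne).
Qed.

Lemma ideal_low_degree (B : set {mpoly K[q]}) d :
  (forall b, B b -> forall i, (i <= d)%N -> component i b = 0) ->
  forall p, ideal_generated B p -> forall i, (i <= d)%N -> component i p = 0.
Proof.
move=> B0 p [k [a [b [Bb ->]]]] i le_id; rewrite raddf_sum /= big1 // => j _.
rewrite pihomogM big1 // => l _.
by rewrite (B0 _ (Bb j)) ?mulr0 // (leq_trans _ le_id) // -ltnS.
Qed.

Lemma ideal_components A p :
  (forall d, ideal_generated A (component d p)) -> ideal_generated A p.
Proof.
move=> Ap; rewrite (pihomog_partitionE (leqnn (mmeasure mdeg p))).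
exact: ideal_sum.
Qed.

(** If the f y are combinations of the h k whose matrix of coefficients is
    invertible modulo the irrelevant ideal, then they generate every h k.  The
    grading replaces the localization of the usual lemma: in degree d, the
    non-constant parts of the coefficients only meet components of the h k of
    degree < d, which are in (f) by induction, so that the matrix of constant
    terms sends the components of degree d of the h k into (f). *)
Lemma graded_nakayama m (f h : 'I_m -> {mpoly K[q]})
    (a : 'I_m -> 'I_m -> {mpoly K[q]}) :
  (forall y, homogeneous (f y)) ->
  (forall y, f y = \sum_k a y k * h k) ->
  (\matrix_(y, k) (a y k)@_0) \in unitmx ->
  forall k, ideal_generated (range f) (h k).
Proof.
move=> f_hom fE; set A := \matrix_(y, k) _ => A_unit k.
apply: ideal_components => d; elim/ltn_ind: d k => d IHd.
have Ah y : ideal_generated (range f) (\sum_k A y k *: component d (h k)).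
  have -> : \sum_k A y k *: component d (h k) =
      component d (f y) -
      \sum_k \sum_(i < d) component (d - i) (a y k) * component i (h k).
    rewrite {1}fE raddf_sum /=; apply/eqP; rewrite eq_sym subr_eq -big_split /=.
    apply/eqP; apply: eq_bigr => k _; rewrite pihomogM big_ord_recr /= addrC subnn.
    by rewrite pihomog0E mul_mpolyC !mxE.
  apply: idealB.
    have [i fi] := f_hom y; rewrite (pihomog_dhomogE d fi).
    by case: eqP => _; [apply: ideal_gen; exists y | apply: ideal0].
  apply: ideal_sum => k _; apply: ideal_sum => i _.
  by apply: idealMl; apply: IHd.
move=> k.
have -> : component d (h k) =
    \sum_y invmx A k y *: \sum_l A y l *: component d (h l).
  under eq_bigr do rewrite scaler_sumr.
  rewrite exchange_big /= (bigD1 k) //= [X in _ + X]big1 ?addr0 => [|l ne].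
    under eq_bigr do rewrite scalerA.
    rewrite -scaler_suml.
    have := mulVmx A_unit => /matrixP/(_ k k); rewrite !mxE eqxx => ->.
    by rewrite scale1r.
  under eq_bigr do rewrite scalerA.
  rewrite -scaler_suml.
  have := mulVmx A_unit => /matrixP/(_ k l); rewrite !mxE eq_sym (negPf ne) => ->.
  by rewrite scale0r.
by apply: ideal_sum => y _; apply: idealZ.
Qed.

(** The points v x witness the linear independence of the f y.  Since the h k
    start in degree 2, the degree 2 part of f y only sees the constant terms of
    its coefficients on the h k; this makes those constant terms a matrix A
    with a right inverse, hence m <= c, and A is invertible when c <= m. *)
Lemma quadrics_vs_generators m c (f : 'I_m -> {mpoly K[q]})
    (h : 'I_c -> {mpoly K[q]}) (v : 'I_m -> 'I_q -> K) :
  (forall y, f y \is 2.-homog) ->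
  (forall y x, (f y).@[v x] = (y == x)%:R) ->
  (forall y, ideal_generated (range h) (f y)) ->
  (forall k i, (i <= 1)%N -> component i (h k) = 0) ->
  (m <= c)%N /\
  ((c <= m)%N -> forall k, ideal_generated (range f) (h k)).
Proof.
move=> f_hom fv fh h_low.
have /fin_all_exists[a fE] y := ideal_range (fh y).
pose A : 'M_(m, c) := \matrix_(y, k) (a y k)@_0.
pose B : 'M_(c, m) := \matrix_(k, x) (component 2 (h k)).@[v x].
have AB : A *m B = 1%:M.
  apply/matrixP=> y x; rewrite !mxE -fv -(pihomog_dE (f_hom y)) fE.
  rewrite (raddf_sum (component 2)) (raddf_sum (meval (v x))).
  apply: eq_bigr => k _; rewrite !mxE /= pihomogM big_ord_recr /= subnn pihomog0E.
  rewrite big1 ?add0r => [|[[|[]]] //= *].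
    by rewrite mul_mpolyC mevalZ.
  1,2: by rewrite h_low ?mulr0.
have le_mc := mulmx1_min AB; split=> // le_cm.
have E : c = m by apply/eqP; rewrite eqn_leq le_cm.
clear le_cm le_mc; subst c; apply: (graded_nakayama (a := a)) => //.
  by move=> y; exists 2%N.
by case/mulmx1_unit: AB.
Qed.

End Homogeneous.

(** * Multilinear expansion and polarization *)

Section Forms.
Variables (K : fieldType) (W : vectType K).

Definition multilinear k (phi : kform W k) : Prop :=
  forall (v : k.-tuple W) (i : 'I_k) (a : K) (x y : W),
    phi (tuple_set v i (a *: x + y)) =
    a * phi (tuple_set v i x) + phi (tuple_set v i y).

Lemma multilinear_iota k (phi : kform W k.+1) x :
  multilinear phi -> multilinear (Defs.iota x phi).
Proof.
have tuple_setS v i y : [tuple of x :: tuple_set v i y] =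
    tuple_set [tuple of x :: v] (lift ord0 i) y :> k.+1.-tuple W.
  apply: eq_from_tnth => j; rewrite tnth_mktuple.
  case: (unliftP ord0 j) => [j' ->|->]; last by rewrite tnth0.
  by rewrite !tnthS tnth_mktuple (inj_eq lift_inj).
by move=> phi_lin v i a y z; rewrite /Defs.iota !tuple_setS phi_lin.
Qed.

Lemma multilinear_sum k (phi : kform W k) (v : k.-tuple W) i (I : finType)
    (c : I -> K) (u : I -> W) :
  multilinear phi ->
  phi (tuple_set v i (\sum_a c a *: u a)) =
  \sum_a c a * phi (tuple_set v i (u a)).
Proof.
move=> phi_lin.
have phi0 : phi (tuple_set v i 0) = 0.
  have := phi_lin v i 1 0 0; rewrite scaler0 addr0 mul1r => E.
  by apply: (addrI (phi (tuple_set v i 0))); rewrite addr0.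
by elim/big_rec2: _ => // a y1 y2 _ <-; rewrite phi_lin.
Qed.

Lemma big_tuple_cons (I : finType) k (G : k.+1.-tuple I -> K) :
  \sum_t G t = \sum_a \sum_(t : k.-tuple I) G [tuple of a :: t].
Proof.
rewrite pair_big /=.
rewrite (reindex (fun p : I * k.-tuple I => [tuple of p.1 :: p.2])) //=.
exists (fun t => (thead t, [tuple of behead t])) => [[a t] _|t _] /=.
  by congr (_, _); apply: val_inj.
by rewrite -tuple_eta.
Qed.

Lemma multilinear_expand (I : finType) k (phi : kform W k)
    (c : I -> K) (u : I -> W) :
  multilinear phi ->
  phi (nseq_tuple k (\sum_a c a *: u a)) =
  \sum_(t : k.-tuple I) (\prod_(a <- t) c a) * phi (map_tuple u t).
Proof.
set w := \sum_a _; elim: k phi => [|k IHk] phi phi_lin.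
  rewrite (bigD1 [tuple]) //= big_nil mul1r big1 ?addr0 => [|t]; last first.
    by rewrite tuple0.
  by congr phi; apply: val_inj.
rewrite big_tuple_cons.
have tuple_set0 y z (t : k.-tuple W) :
    tuple_set [tuple of z :: t] ord0 y = [tuple of y :: t].
  apply: eq_from_tnth => j; rewrite tnth_mktuple.
  case: (unliftP ord0 j) => [j' ->|->]; last by rewrite tnth0.
  by rewrite !tnthS.
have -> : nseq_tuple k.+1 w = tuple_set [tuple of 0 :: nseq_tuple k w] ord0 w.
  by rewrite tuple_set0; apply: val_inj.
rewrite multilinear_sum //; apply: eq_bigr => a _.
rewrite tuple_set0 -/(Defs.iota (u a) phi (nseq_tuple k w)) IHk; last first.
  exact: multilinear_iota.
rewrite mulr_sumr; apply: eq_bigr => t _; rewrite big_cons mulrA; congr (_ * _).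
by rewrite /Defs.iota; congr phi; apply: val_inj.
Qed.

Lemma multilinear_diagZ k (phi : kform W k) a w :
  multilinear phi ->
  phi (nseq_tuple k (a *: w)) = a ^+ k * phi (nseq_tuple k w).
Proof.
move=> phi_lin.
have /= := multilinear_expand (fun _ : 'I_1 => a) (fun _ => w) phi_lin.
rewrite big_ord1 => ->; rewrite (big_pred1 (nseq_tuple k ord0)) => [|t].
  rewrite /= big_nseq iter_mulr mulr1; congr (_ * phi _).
  by apply: val_inj; rewrite /= map_nseq.
by symmetry; apply/eqP/eq_from_tnth => i; rewrite !ord1.
Qed.

Lemma form_polyE n (e : n.-tuple W) k (phi : kform W k) w :
  basis_of fullv e -> multilinear phi ->
  phi (nseq_tuple k w) = (form_poly e phi).@[fun i => coord e i w].
Proof.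
move=> e_basis phi_lin; rewrite {1}(coord_basis e_basis (memvf w)).
under eq_bigr do rewrite -tnth_nth.
rewrite multilinear_expand // raddf_sum /=; apply: eq_bigr => t _.
rewrite mevalZ rmorph_prod /= mulrC; congr (_ * _).
by apply: eq_bigr => i _; rewrite mevalXU.
Qed.

Lemma form_poly_homog n (e : n.-tuple W) k (phi : kform W k) :
  form_poly e phi \is k.-homog.
Proof.
apply: rpred_sum => t _; apply: dhomogZ.
rewrite -{2}(size_tuple t); elim: (val t) => [|i s IHs] /=.
  by rewrite big_nil dhomog1.
rewrite big_cons -add1n; apply: dhomogM => //.
by rewrite dhomogX /= mdeg1.
Qed.

Lemma symform_sum k (I : finType) (c : I -> K) (phi : I -> kform W k) :
  (forall i, is_symform (phi i)) -> is_symform (fun v => \sum_i c i * phi i v).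
Proof.
move=> phi_sym; split=> [v i a x y|v sigma]; last first.
  by apply: eq_bigr => i _; have [_ ->] := phi_sym i.
rewrite mulr_sumr -big_split; apply: eq_bigr => j _ /=.
by have [-> _] := phi_sym j; rewrite mulrDr mulrCA.
Qed.

End Forms.

(** Sum phi on the diagonal at the vectors sum_(i in S) v_i, over all the sets S
    of indices and with the sign (-1)^(k - |S|).  Expanding and exchanging the
    sums, the coefficient of phi (v_(t_1), ..., v_(t_k)) is the product over i
    of 1 - [i not in t]: only the tuples t that contain every index survive.
    These are permutations, so the sum is a positive multiple of phi v. *)
Lemma polarization (K : numFieldType) (W : vectType K) k (phi : kform W k) :
  is_symform phi -> (forall w, phi (nseq_tuple k w) = 0) ->
  forall v, phi v = 0.
Proof.
move=> [phi_lin phi_sym] phi0 v.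
pose sg (b : bool) : K := if b then 1 else -1.
have sum0 : \sum_(b : {ffun 'I_k -> bool}) (\prod_i sg (b i)) *
    phi (nseq_tuple k (\sum_i (b i)%:R *: tnth v i)) = 0.
  by apply: big1 => b _; rewrite phi0 mulr0.
pose N := \sum_(t : k.-tuple 'I_k | [forall i, i \in t]) (1 : K).
have sumE : \sum_(b : {ffun 'I_k -> bool}) (\prod_i sg (b i)) *
    phi (nseq_tuple k (\sum_i (b i)%:R *: tnth v i)) = N * phi v.
  under eq_bigr => b _ do rewrite multilinear_expand // mulr_sumr.
  rewrite exchange_big /= mulr_suml [RHS]big_mkcond /=; apply: eq_bigr => t _.
  under eq_bigr do rewrite mulrA.
  rewrite -mulr_suml.
  have -> : \sum_(b : {ffun 'I_k -> bool})
      (\prod_i sg (b i)) * (\prod_(i <- t) (b i)%:R) =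
      \prod_i ((i \in t)%:R : K).
    (* As b is 0 or 1, its powers only depend on whether i occurs in t. *)
    transitivity (\prod_(i : 'I_k) \sum_(b : bool)
        sg b * (if i \in t then b%:R else 1)).
      rewrite bigA_distr_bigA; apply: eq_bigr => b _; rewrite big_split /=.
      congr (_ * _); rewrite -big_mkcond /=.
      have [bt|] := boolP [forall i in t, b i].
        rewrite big1_seq ?big1 // => i; first by move=> /(forall_inP bt) ->.
        by case/andP=> _ /(forall_inP bt) ->.
      rewrite negb_forall => /existsP[j]; rewrite negb_imply => /andP[jt /negPf bj].
      rewrite [RHS](bigD1 j) //= bj mul0r; apply/eqP; rewrite prodf_seq_eq0.
      by apply/hasP; exists j => //=; rewrite bj.
    apply: eq_bigr => i _; rewrite big_bool /sg /= mul1r mulN1r.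
    by case: ifP; rewrite ?subrr ?subr0.
  case: forallP => [t_all|t_all].
    rewrite big1 ?mul1r => [|i _]; last by rewrite t_all.
    have t_inj : injective (tnth t).
      apply/tuple_uniqP; apply: (leq_size_uniq (enum_uniq 'I_k)) => [i _|] //.
      by rewrite size_tuple size_enum_ord.
    rewrite -[RHS](phi_sym v (perm t_inj)); congr phi; apply: eq_from_tnth => i.
    by rewrite tnth_map tnth_mktuple permE.
  have /existsP[j jt] : [exists j, j \notin t].
    by rewrite -negb_forall; apply/forallP.
  by rewrite (bigD1 j) //= (negPf jt) mul0r mul0r.
have N_gt0 : 0 < N.
  rewrite /N (bigD1 (ord_tuple k)) /=; last first.
    by apply/forallP=> i; have := mem_enum 'I_k i.
  by rewrite ltr_pwDl ?ltr01 // sumr_ge0.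
by move/eqP: sum0; rewrite sumE mulf_eq0 gt_eqF //= => /eqP.
Qed.

(** * Zariski closures *)

Section ZariskiClosure.
Variables (K : fieldType) (q : nat).
Implicit Types (A : set ('I_q -> K)) (p : {mpoly K[q]}).

Lemma subset_zariski_closure A : A `<=` zariski_closure A.
Proof. by move=> v Av Y _; apply. Qed.

Lemma zariski_closureE A : A `<=` @proj_vector K q ->
  zariski_closure A =
  zero_locus [set p | homogeneous p /\ forall v, A v -> p.@[v] = 0].
Proof.
move=> A_proj; apply/seteqP; split=> [v|v [v_proj v0] _ [S [S_hom ->]] AS].
  apply; last by move=> u Au; split=> [|p [_]]; [apply: A_proj|apply].
  by eexists; split; last reflexivity; move=> p [].
split=> // p Sp; apply: v0; split; first exact: S_hom.
by move=> u /AS[_]; apply.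
Qed.

Lemma zariski_closed_closure A :
  A `<=` @proj_vector K q -> zariski_closed (zariski_closure A).
Proof.
by move=> /zariski_closureE->; eexists; split; last reflexivity; move=> p [].
Qed.

Lemma vanish_closure A p : A `<=` @proj_vector K q -> homogeneous p ->
  (forall v, A v -> p.@[v] = 0) -> forall v, zariski_closure A v -> p.@[v] = 0.
Proof. by move=> /zariski_closureE-> p_hom pA v [_]; apply. Qed.

Lemma zariski_closure_sub A Y :
  zariski_closed Y -> A `<=` Y -> zariski_closure A `<=` Y.
Proof. by move=> Yc AY v; apply. Qed.

Lemma zariski_closureS A B :
  A `<=` B -> zariski_closure A `<=` zariski_closure B.
Proof. by move=> AB v vA Y Yc BY; apply: vA => // u /AB/BY. Qed.

(** The condition says that two nonempty open subsets of A meet.  A closed set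
    that does not contain the closure of A already misses a point of A, so this
    property of A passes to its closure. *)
Lemma irreducible_closure A : A !=set0 -> A `<=` @proj_vector K q ->
  (forall p1 p2 v1 v2, A v1 -> p1.@[v1] != 0 -> A v2 -> p2.@[v2] != 0 ->
     exists v, [/\ A v, p1.@[v] != 0 & p2.@[v] != 0]) ->
  irreducible_set (zariski_closure A).
Proof.
move=> [v0 Av0] A_proj A_dom; split.
  by exists v0; apply: subset_zariski_closure.
have witness Y : zariski_closed Y -> ~ zariski_closure A `<=` Y ->
    exists p v, [/\ A v, p.@[v] != 0 & forall u, Y u -> p.@[u] = 0].
  move=> Yc nAY; apply: boolp.contrapT => none; apply: nAY.
  apply: zariski_closure_sub => // v Av.
  have [S [_ YE]] := Yc; rewrite YE; split=> [|p Sp]; first exact: A_proj.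
  apply/eqP; apply: boolp.contrapT => /negP pv.
  apply: none; exists p, v; split=> // u.
  by rewrite YE => -[_]; apply.
move=> Y1 Y2 Y1c Y2c AY; apply: boolp.contrapT => /boolp.not_orP[nY1 nY2].
have [p1 [v1 [Av1 p1v p1Y]]] := witness _ Y1c nY1.
have [p2 [v2 [Av2 p2v p2Y]]] := witness _ Y2c nY2.
have [v [Av p1v0 p2v0]] := A_dom _ _ _ _ Av1 p1v Av2 p2v.
by have [/p1Y/eqP|/p2Y/eqP] := AY _ (subset_zariski_closure Av); apply/negP.
Qed.

End ZariskiClosure.

(** * Evaluation of polynomials *)

Section Evaluation.

(** A polynomial function restricted to a polynomial curve is given by a
    polynomial in the parameter. *)
Lemma meval_path (K : fieldType) q (p : {mpoly K[q]}) (u : 'I_q -> {poly K}) a :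
  p.@[fun i => (u i).[a]] = (mmap polyC u p).[a].
Proof.
rewrite mevalE /mmap horner_sum; apply: eq_bigr => m _.
rewrite hornerM hornerC /mmap1 horner_prod; congr (_ * _).
by apply: eq_bigr => i _; rewrite horner_exp.
Qed.

Lemma poly_eq0_horner (K : numDomainType) (P : {poly K}) :
  (forall a, P.[a] = 0) -> P = 0.
Proof.
move=> P0; apply/eqP; apply: contraT => Pn0.
have := max_poly_roots Pn0 (rs := [seq i%:R | i <- seq.iota 0 (size P)]).
rewrite size_map size_iota ltnn; apply.
  by apply/allP=> x _; apply/rootP.
by rewrite map_inj_uniq ?iota_uniq // => i j /eqP; rewrite eqr_nat => /eqP.
Qed.

Lemma meval_homogZ (K : fieldType) q d (p : {mpoly K[q]}) a v :
  p \is d.-homog -> p.@[fun i => a * v i] = a ^+ d * p.@[v].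
Proof.
move=> /dhomogP p_hom; rewrite !mevalE mulr_sumr; apply: eq_big_seq => m /p_hom <-.
rewrite mulrCA; congr (_ * _); under eq_bigr do rewrite exprMn.
by rewrite big_split /= prodrXr mdegE.
Qed.

Lemma homog1E (K : fieldType) q (p : {mpoly K[q]}) :
  p \is 1.-homog -> p = \sum_i p@_U_(i) *: 'X_i.
Proof.
move=> p_hom; apply/mpolyP=> m; rewrite raddf_sum /=.
under eq_bigr do rewrite mcoeffZ mcoeffX.
have [/mdeg1P[l /eqP->]|m1] := boolP (mdeg m == 1%N).
  rewrite (bigD1 l) //= eqxx mulr1 big1 ?addr0 // => i ne.
  by rewrite eq_mnm1 (negPf ne) mulr0.
rewrite (dhomog_nemf_coeff p_hom m1) big1 // => i _.
by case: eqP => [E|]; [rewrite -E mdeg1 in m1|rewrite mulr0].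
Qed.

Lemma comp_mpoly_homog (K : fieldType) n q d (p : {mpoly K[n]})
    (u : n.-tuple {mpoly K[q]}) :
  p \is d.-homog -> (forall i, tnth u i \is 1.-homog) -> p \mPo u \is d.-homog.
Proof.
move=> /dhomogP p_hom u_hom; rewrite comp_mpolyEX big_seq.
apply: rpred_sum => m /p_hom <-; rewrite dhomogZ // comp_mpolyX /= mdegE.
elim/big_ind2: _ => [|a b x y ? ?|i _]; first exact: dhomog1.
  exact: dhomogM.
by have := dhomogMn (m i) (u_hom i); rewrite mul1n.
Qed.

End Evaluation.

(** * The variety M(F): linear forms and dimension *)

Section EulerMap.
Variables (K : numFieldType) (W : vectType K) (n r : nat) (e : n.-tuple W).
Variables (s : nat -> nat) (Q : forall k, 'I_(s k) -> kform W k).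
Hypothesis e_basis : basis_of fullv e.
Hypothesis Q_sym : forall (j : 'I_r.-1) (i : 'I_(s j.+2)), is_symform (Q i).
Hypothesis Q_free : forall (j : 'I_r.-1) (c : 'I_(s j.+2) -> K),
  (forall v, \sum_i c i * Q i v = 0) -> forall i, c i = 0.

Local Notation vidx := (vindex n r s).
Local Notation zidx i := (Some (inl i) : vidx).
Local Notation widx j i :=
  (Some (inr (existT (fun j : 'I_r.-1 => 'I_(s j.+2)) j i)) : vidx).

Definition euler_point (t : K) (w : W) : 'I_#|vidx| -> K :=
  fun i => euler_map e Q t w (enum_val i).

Lemma big_vindex (G : vidx -> K) :
  \sum_x G x = G None + (\sum_i G (zidx i) + \sum_j \sum_i G (widx j i)).
Proof.
rewrite (bigD1 None) //=; congr (_ + _).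
rewrite (reindex_omap Some id) /= => [|[x|]//].
under eq_bigl do rewrite eqxx.
rewrite big_sumType /=; congr (_ + _).
rewrite (sig_big_dep xpredT (fun _ => xpredT) (fun j i => G (widx j i))) /=.
by apply: eq_bigr => -[j i].
Qed.

Lemma card_vindex : #|vidx| = (n + \sum_(2 <= k < r.+1) s k).+1.
Proof.
rewrite card_option card_sum card_ord card_tagged sumnE big_map big_enum /=.
congr (_ + _).+1; under eq_bigr do rewrite card_ord.
by rewrite !big_add1 big_mkord.
Qed.

(** The degree in w of the coordinate x of [euler_map 1 w]. *)
Definition vweight (x : vidx) : nat :=
  match x with None => 0 | Some (inl _) => 1 | Some (inr y) => (tag y).+2 end.

Lemma euler_mapZ a w x :
  euler_map e Q 1 (a *: w) x = a ^+ vweight x * euler_map e Q 1 w x.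
Proof.
case: x => [[i|[j i]]|] /=; rewrite !expr1n ?mul1r //.
  by rewrite linearZ /= expr1.
by rewrite multilinear_diagZ //; case: (Q_sym i).
Qed.

(** Replacing w by a *: w turns a linear relation between the coordinates into a
    polynomial in a that vanishes identically.  So the relation splits by
    degree, and the part of degree k >= 2 is a combination of the forms
    Q_i^(k) that vanishes on the diagonal, hence is zero by polarization. *)
Lemma euler_map_free (c : vidx -> K) :
  (forall w, \sum_x c x * euler_map e Q 1 w x = 0) -> forall x, c x = 0.
Proof.
move=> c0.
have graded0 k w : \sum_(x | vweight x == k) c x * euler_map e Q 1 w x = 0.
  pose P : {poly K} := \sum_x (c x * euler_map e Q 1 w x) *: 'X^(vweight x).
  have : P = 0.
    apply: poly_eq0_horner => a; rewrite horner_sum -[RHS](c0 (a *: w)).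
    apply: eq_bigr => x _; rewrite hornerZ hornerXn euler_mapZ -mulrA.
    by rewrite [_ * a ^+ _]mulrC.
  move/(congr1 (fun P : {poly K} => P`_k)); rewrite coef0 coef_sum => P0.
  rewrite -[RHS]P0.
  rewrite big_mkcond /=; apply: eq_bigr => x _.
  by rewrite coefZ coefXn eq_sym; case: eqP; rewrite ?mulr1 ?mulr0.
have split0 k w := etrans (esym (big_vindex _))
  (etrans (esym (big_mkcond _ _)) (graded0 k w)).
case=> [[i|[j i]]|].
- have := split0 1%N (tnth e i).
  rewrite /= add0r [X in _ + X]big1 ?addr0 => [|j _]; last by rewrite big1.
  rewrite (bigD1 i) //= big1 ?addr0 => [|l ne].
    by rewrite expr1n mul1r (tnth_nth 0) coord_free ?(basis_free e_basis) // eqxx mulr1.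
  rewrite expr1n mul1r (tnth_nth 0) coord_free ?(basis_free e_basis) //.
  by rewrite eq_sym (negPf ne) mulr0.
- apply: (@Q_free j (fun i => c (widx j i))) i.
  apply: polarization => [|w]; first exact: symform_sum.
  have := split0 j.+2 w.
  rewrite /= add0r [X in X + _]big1 ?add0r // (bigD1 j) //=.
  rewrite [X in _ + X]big1 ?addr0.
    rewrite eqxx => wt0; rewrite -[RHS]wt0; apply: eq_bigr => i _.
    by rewrite expr1n mul1r.
  move=> l ne; rewrite big1 // => i _; rewrite !eqSS.
  by case: eqP => // /val_inj E; case/eqP: ne.
- have := split0 0%N 0.
  rewrite /= expr1n mulr1 [X in _ + (X + _)]big1 // [X in _ + (_ + X)]big1 ?addr0 //.
  by move=> j _; rewrite big1.
Qed.

Lemma euler_point_proj w : proj_vector (euler_point 1 w).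
Proof.
by exists (enum_rank None); rewrite /euler_point enum_rankK /= expr1n oner_neq0.
Qed.

Lemma euler_image_point1 w : euler_image e Q (euler_point 1 w).
Proof. by split; [apply: euler_point_proj | exists 1, w]. Qed.

Lemma euler_variety_low_degree p :
  vanishing_ideal (euler_variety r e Q) p ->
  forall i, (i <= 1)%N -> pihomog mdeg i p = 0.
Proof.
move: p; apply: ideal_low_degree => p [[d p_hom] p0] i le_i1.
rewrite (pihomog_dhomogE i p_hom); case: eqP => // E.
move: le_i1; rewrite -{i}E => le_d1.
have p1 w : p.@[euler_point 1 w] = 0.
  by apply: p0; apply: subset_zariski_closure; apply: euler_image_point1.
case: d le_d1 p_hom => [_|[_|//]] p_hom.
  have pC := pihomog0E p; rewrite (pihomog_dE p_hom) in pC.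
  by have := p1 0; rewrite pC mevalC => ->; rewrite mpolyC0.
rewrite (homog1E p_hom) big1 // => i _.
have c0 := @euler_map_free (fun x => p@_U_(enum_rank x)).
rewrite -(enum_valK i) c0 ?scale0r // => w.
rewrite -[RHS](p1 w) {2}(homog1E p_hom) raddf_sum /=.
rewrite (reindex enum_rank) /=; last first.
  by apply: onW_bij; apply: enum_rank_bij.
by apply: eq_bigr => x _; rewrite mevalZ mevalXU /euler_point enum_rankK.
Qed.

Lemma euler_point_path w u i :
  exists P : {poly K}, forall a, P.[a] = euler_point 1 (w + a *: u) i.
Proof.
rewrite /euler_point; case: (enum_val i) => [[l|[j l]]|] /=.
- exists ((coord e l w)%:P + coord e l u *: 'X) => a.
  by rewrite expr1n mul1r !hornerE linearD linearZ /= mulrC.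
- pose line b := (coord e b w)%:P + coord e b u *: 'X.
  exists (mmap polyC line (form_poly e (Q l))) => a.
  have [Ql _] := Q_sym l.
  rewrite expr1n mul1r (form_polyE _ e_basis Ql) -meval_path; apply: meval_eq => b.
  by rewrite !hornerE linearD linearZ /= mulrC.
- by exists 1 => a; rewrite hornerE expr1n.
Qed.

(** The images of the spans of the first d basis vectors, in the chart t = 1.
    Working in this chart keeps all the points of a parameter line nonzero. *)
Definition euler_flag (d : nat) : set ('I_#|vidx| -> K) :=
  [set v | exists2 w, (forall l : 'I_n, (d <= l)%N -> coord e l w = 0) &
                      v = euler_point 1 w].

Lemma euler_flag_proj d : euler_flag d `<=` @proj_vector K _.
Proof. by move=> _ [w _ ->]; apply: euler_point_proj. Qed.

(** On the line of parameters through two given points, a polynomial which does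
    not vanish at one of them restricts to a nonzero polynomial in one variable,
    and the product of two such polynomials has a value other than zero. *)
Lemma euler_flag_irreducible d : irreducible_set (zariski_closure (euler_flag d)).
Proof.
apply: irreducible_closure; last 1 first.
- move=> p1 p2 _ _ [w1 w1d ->] p1w [w2 w2d ->] p2w.
  have /fin_all_exists[u uE] := euler_point_path w1 (w2 - w1).
  pose P p := mmap polyC u p.
  have PE p a : (P p).[a] = p.@[euler_point 1 (w1 + a *: (w2 - w1))].
    by rewrite /P -meval_path; apply: meval_eq => i; rewrite uE.
  have P1 : P p1 != 0.
    apply: contraNneq p1w => P0; have := PE p1 0; rewrite P0 horner0 scale0r addr0.
    by move<-.
  have P2 : P p2 != 0.
    apply: contraNneq p2w => P0; have := PE p2 1; rewrite P0 horner0 scale1r.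
    by rewrite addrCA subrr addr0 => <-.
  have [a Pa] : exists a, (P p1 * P p2).[a] != 0.
    apply: boolp.contrapT => none; case/eqP: (mulf_neq0 P1 P2).
    apply: poly_eq0_horner => a; apply/eqP; apply: boolp.contrapT => /negP ?.
    by apply: none; exists a.
  move: Pa; rewrite hornerM mulf_eq0 negb_or !PE => /andP[Pa1 Pa2].
  exists (euler_point 1 (w1 + a *: (w2 - w1))); split=> //.
  exists (w1 + a *: (w2 - w1)) => // l le_dl.
  by rewrite linearD linearZ linearB /= w1d // w2d // subrr mulr0 addr0.
- by exists (euler_point 1 0), 0 => // l _; rewrite linear0.
- exact: euler_flag_proj.
Qed.

(** The coordinate z_(d+1) vanishes on the d-th member of the chain, but not on
    the next one; this makes the inclusions strict. *)
Lemma euler_variety_chain : irreducible_chain (euler_variety r e Q) n.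
Proof.
exists (fun d => zariski_closure (euler_flag d)); split=> d le_dn.
  split; first exact: zariski_closed_closure (@euler_flag_proj d).
    exact: euler_flag_irreducible.
  by apply: zariski_closureS => _ [w _ ->]; apply: euler_image_point1.
split; first by apply: zariski_closureS => _ [w wd ->]; exists w => // l /ltnW/wd.
move=> sub; pose l := Ordinal le_dn.
have zd v : zariski_closure (euler_flag d) v -> (zvar K r s l).@[v] = 0.
  apply: vanish_closure; first exact: euler_flag_proj.
    by exists 1%N; rewrite dhomogX /= mdeg1.
  by move=> _ [w wd ->]; rewrite mevalXU /euler_point enum_rankK /= wd // mulr0.
have /zd : zariski_closure (euler_flag d) (euler_point 1 (tnth e l)).
  apply: sub; apply: subset_zariski_closure; exists (tnth e l) => // b lt_db.
  rewrite (tnth_nth 0) coord_free ?(basis_free e_basis) //.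
  by case: eqP lt_db => // <-; rewrite ltnn.
rewrite mevalXU /euler_point enum_rankK /= expr1n mul1r (tnth_nth 0).
by rewrite coord_free ?(basis_free e_basis) // eqxx => /eqP; rewrite oner_eq0.
Qed.

(** * The quadrics *)

Section Quadrics.
Variable g : forall k, 'I_(s k.+1) -> 'I_(s k) -> {mpoly K[n]}.
Hypothesis g_rel : linear_relations r e Q g.

Lemma in_z_homog d (p : {mpoly K[n]}) : p \is d.-homog -> in_z r s p \is d.-homog.
Proof.
move=> p_hom; apply: comp_mpoly_homog => // i.
by rewrite tnth_mktuple dhomogX /= mdeg1.
Qed.

Lemma quadric_homog j (hj : (j < r.-1)%N) i : quadric e Q g hj i \is 2.-homog.
Proof.
have X1 x : ('X_x : {mpoly K[#|vidx|]}) \is 1.-homog by rewrite dhomogX /= mdeg1.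
case: j hj i => [|j] hj i /=; apply: rpredB; try exact: (dhomogM (X1 _) (X1 _)).
  exact/in_z_homog/form_poly_homog.
apply: rpred_sum => l _; apply: (@dhomogM _ _ _ 1 _ 1); last exact: X1.
apply: in_z_homog.
have hk : (2 <= j.+2 < r)%N by rewrite /= -ltn_predRL.
by have [-> _] := g_rel hk i.
Qed.

Lemma meval_in_z d (p : {mpoly K[n]}) t w : p \is d.-homog ->
  (in_z r s p).@[euler_point t w] =
  t ^+ (r.-1 * d) * p.@[fun i => coord e i w].
Proof.
move=> p_hom; rewrite comp_mpoly_meval exprM -meval_homogZ //; apply: meval_eq => i.
by rewrite tnth_mktuple mevalXU /euler_point enum_rankK.
Qed.

Lemma quadric_vanish j (hj : (j < r.-1)%N) i t w :
  (quadric e Q g hj i).@[euler_point t w] = 0.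
Proof.
have evX x : ('X_(enum_rank x)).@[euler_point t w] = euler_map e Q t w x.
  by rewrite mevalXU /euler_point enum_rankK.
have QE (l : 'I_r.-1) b :
    (form_poly e (Q b)).@[fun i => coord e i w] = Q b (nseq_tuple l.+2 w).
  by have [Q_lin _] := Q_sym b; rewrite (form_polyE _ e_basis Q_lin).
case: j hj i => [|j] hj i /=.
  rewrite mevalB mevalM !evX /= (meval_in_z _ _ (form_poly_homog _ _)).
  rewrite (QE (Ordinal hj)) mulrA -exprD; apply/eqP; rewrite subr_eq0; apply/eqP.
  by congr (_ ^+ _ * _); case: (r) hj => [|[|r']] //= _; lia.
have hk : (2 <= j.+2 < r)%N by rewrite /= -ltn_predRL.
have [g_hom gE] := g_rel hk i.
rewrite mevalB mevalM !evX (raddf_sum (meval _)) /=.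
rewrite -(QE (Ordinal hj)) gE (raddf_sum (meval ((coord e)^~ w))) /=.
rewrite mulrA -exprD mulr_sumr -sumrB big1 // => l _.
rewrite !mevalM evX /= (meval_in_z _ _ (g_hom l)) -(QE (Ordinal (ltnW hj))).
apply/eqP; rewrite subr_eq0; apply/eqP; rewrite mulrACA -exprD muln1.
by congr (_ ^+ _ * _); case: (r) hj => [|[|r']] //= ?; lia.
Qed.

Definition wpoint (y : {j : 'I_r.-1 & 'I_(s j.+2)}) : 'I_#|vidx| -> K :=
  fun i => match enum_val i with
           | None => 1 | Some (inl _) => 0 | Some (inr y') => (y' == y)%:R end.

(** Among the monomials of f_i^(j), only z_0 w_i^(j) is not divisible by one of
    z_1, ..., z_n. *)
Lemma quadric_wpoint j (hj : (j < r.-1)%N) (i : 'I_(s j.+2)) y :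
  (quadric e Q g hj i).@[wpoint y] =
  (existT (fun j : 'I_r.-1 => 'I_(s j.+2)) (Ordinal hj) i == y)%:R.
Proof.
have in_z0 d (p : {mpoly K[n]}) :
    p \is d.+1.-homog -> (in_z r s p).@[wpoint y] = 0.
  move=> p_hom; rewrite comp_mpoly_meval.
  rewrite (meval_eq _ (v2 := fun _ => 0 * 0)) => [|b]; last first.
    by rewrite tnth_mktuple mevalXU /wpoint enum_rankK mul0r.
  by rewrite (meval_homogZ 0 _ p_hom) expr0n mul0r.
have z0E : (zvar0 K n r s).@[wpoint y] = 1 by rewrite mevalXU /wpoint enum_rankK.
have wE : (wvar K n hj i).@[wpoint y] =
    (existT (fun j : 'I_r.-1 => 'I_(s j.+2)) (Ordinal hj) i == y)%:R.
  by rewrite mevalXU /wpoint enum_rankK.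
case: j hj i wE => [|j] hj i wE /=.
  by rewrite mevalB mevalM z0E wE (in_z0 1%N) ?form_poly_homog // mul1r subr0.
rewrite mevalB mevalM z0E wE mul1r (raddf_sum (meval _)) big1 ?subr0 // => l _.
have hk : (2 <= j.+2 < r)%N by rewrite /= -ltn_predRL.
have [g_hom _] := g_rel hk i.
by rewrite /= mevalM (in_z0 0%N) ?mul0r.
Qed.

Definition quadric_of (y : {j : 'I_r.-1 & 'I_(s j.+2)}) : {mpoly K[#|vidx|]} :=
  let: existT (Ordinal _ hj) i := y in quadric e Q g hj i.

Lemma quadric_of_wpoint y y' : (quadric_of y).@[wpoint y'] = (y == y')%:R.
Proof. by case: y => -[j hj] i; apply: quadric_wpoint. Qed.

Lemma quadricsE : quadrics r e Q g = range quadric_of.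
Proof.
apply/seteqP; split=> [_ [j [hj [i ->]]]|_ [[[j hj] i] _ <-]].
  by exists (existT _ (Ordinal hj) i).
by exists j, hj, i.
Qed.

Lemma quadric_in_ideal f :
  quadrics r e Q g f -> vanishing_ideal (euler_variety r e Q) f.
Proof.
move=> [j [hj [i ->]]]; apply: ideal_gen.
have f_hom : homogeneous (quadric e Q g hj i) by exists 2%N; apply: quadric_homog.
split=> // v; apply: vanish_closure => // [u []//|u [_ [t [w ->]]]].
exact: quadric_vanish.
Qed.

Lemma euler_complete_intersection c (h : 'I_c -> {mpoly K[#|vidx|]}) :
  proj_codim (euler_variety r e Q) c ->
  vanishing_ideal (euler_variety r e Q) = ideal_generated (range h) ->
  c = (\sum_(2 <= k < r.+1) s k)%N /\
  vanishing_ideal (euler_variety r e Q) = ideal_generated (quadrics r e Q g).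
Proof.
move=> [d [_ d_max] dcE] IE.
pose Y := {j : 'I_r.-1 & 'I_(s j.+2)}.
have cardY : #|{: Y}| = (\sum_(2 <= k < r.+1) s k)%N.
  by move: card_vindex; rewrite card_option card_sum card_ord => -[] /addnI.
(* d >= n because of the chain, and d + c = n + m. *)
have le_c : (c <= #|{: Y}|)%N.
  rewrite cardY; have le_nd := d_max _ euler_variety_chain.
  move: dcE; rewrite card_vindex => -[dcE].
  by rewrite -(leq_add2l n) -dcE leq_add2r.
have [le_Y hf] : (#|{: Y}| <= c)%N /\
    ((c <= #|{: Y}|)%N -> forall k,
      ideal_generated (range (quadric_of \o @enum_val Y xpredT)) (h k)).
  apply: (quadrics_vs_generators (v := fun x => wpoint (enum_val x))).
  - move=> y; rewrite /= /quadric_of; case: (enum_val y) => -[j hj] i.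
    exact: quadric_homog.
  - by move=> y x; rewrite /= quadric_of_wpoint (inj_eq enum_val_inj).
  - move=> y; rewrite -IE; apply: quadric_in_ideal; rewrite quadricsE.
    by exists (enum_val y).
  - move=> k; apply: euler_variety_low_degree.
    by rewrite IE; apply: ideal_gen; exists k.
split; first by rewrite -cardY; apply/eqP; rewrite eqn_leq le_c le_Y.
apply/seteqP; split; last exact/ideal_generated_sub/quadric_in_ideal.
rewrite IE; apply: ideal_generated_sub => _ [k _ <-].
apply: ideal_generated_sub (hf le_c k) => _ [y _ <-]; apply: ideal_gen.
by rewrite quadricsE; exists (enum_val y).
Qed.

End Quadrics.
End EulerMap.

(** * The theorem *)

Theorem proposition3p1 (R : realType) (W : vectType R[i]) (n r : nat)
    (e : n.-tuple W) (F : forall k, set (kform W k)) (s : nat -> nat)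
    (Q : forall k, 'I_(s k) -> kform W k)
    (g : forall k, 'I_(s k.+1) -> 'I_(s k) -> {mpoly R[i][n]}) :
  basis_of fullv e ->
  (2 <= r)%N ->
  symbol_system r F ->
  (forall k, (2 <= k <= r)%N -> form_basis (F k) (Q k)) ->
  linear_relations r e Q g ->
  complete_intersection (euler_variety r e Q) ->
  proj_codim (euler_variety r e Q) (\sum_(2 <= k < r.+1) s k)%N /\
  vanishing_ideal (euler_variety r e Q) =
    ideal_generated (quadrics r e Q g).
Proof.
move=> e_basis r_ge2 F_symb Q_basis g_rel [c c_codim [h hE]].
have deg_bound (j : 'I_r.-1) : (2 <= j.+2 <= r)%N.
  by rewrite /= -ltn_predRL.
have Q_sym (j : 'I_r.-1) (i : 'I_(s j.+2)) : is_symform (@Q j.+2 i).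
  have [F_sym _ _] := symbol_subspace F_symb j.+2; apply: F_sym.
  by have [FQ _ _] := Q_basis _ (deg_bound j); apply: FQ.
have Q_free (j : 'I_r.-1) (a : 'I_(s j.+2) -> R[i]) :
    (forall v, \sum_i a i * @Q j.+2 i v = 0) -> forall i, a i = 0.
  by have [_ _] := Q_basis _ (deg_bound j); apply.
have [<- IE] := euler_complete_intersection e_basis Q_sym Q_free g_rel c_codim hE.
by split.
Qed.
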